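(* Let $d\ge 2$, let $A\in\{0,\ast\}^{d\times d}$, let $F\subset\mathcal{A}=\{x_1,\dots,x_d\}$ with $\mathcal{A}\setminus F\neq\emptyset$, let the output matrix be $C=I_F\in\{0,\ast\}^{|F|\times d}$, and suppose that $\mu(A,I_F)\le 2$. Let $G(A)=(\mathcal{A},E_A)$ be the digraph of $A$ and let $J^*$ be any set obtained by the following procedure. (1) Form the undirected graph $G_u=(\mathcal{A},E_u)$ with $E_u=E_F\sqcup E_{\mathcal{A}\setminus F}$ (self-loops are discarded), where $\{x_i,x_j\}\in E_F$ iff $x_i,x_j\in F$, $x_i\ne x_j$, and $(x_i,x_j)\in E_A$ or $(x_j,x_i)\in E_A$; and $\{x_k,x_m\}\in E_{\mathcal{A}\setminus F}$ iff $x_k\in\mathcal{A}\setminus F$, $x_m\in F$ and $(x_k,x_m)\in E_A$. (2) Give weight $w(e)=1$ to each $e\in E_F$ and weight $w(e)=|E_u|+1$ to each $e\in E_{\mathcal{A}\setminus F}$. (3) Let $M$ be a maximum weight matching of $G_u$ with respect to $w$. (4) Let $J^*$ consist of all vertices not saturated by $M$ together with one endpoint of each edge of $M$, chosen as follows: from an edge $\{x_i,x_j\}\in M$ choose an endpoint $x_j$ such that $(x_i,x_j)\in E_A$; if both $(x_i,x_j)$ and $(x_j,x_i)$ lie in $E_A$ either endpoint may be chosen, except that from an edge in $E_{\mathcal{A}\setminus F}$ the endpoint lying in $F$ is chosen. Then $J^*\subset F$ and $J^*$ is an optimal solution of the problem $$\min_{J\subset F}\ |J|\quad\text{subject to}\quad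 \mu(A,I_J)\le 2 .$$
   Context: Notation: $[d]=\{1,\dots,d\}$. A sparsity matrix is a matrix with entries in $\{0,\ast\}$, where $0$ is a fixed zero and each $\ast$ is an independent free real parameter. For a sparsity matrix $H$, $[H]$ is the set of all real matrices of the same size obtained by giving numerical values to the $\ast$ entries (entries $0$ stay zero). For $A\in\{0,\ast\}^{d\times d}$, the digraph $G(A)=(\mathcal{A},E_A)$ has state vertices $\mathcal{A}=\{x_1,\dots,x_d\}$ and edges $E_A=\{(x_j,x_i): A_{ij}\ne 0\}$. For $J\subset\mathcal{A}$, $I_J\in\{0,\ast\}^{|J|\times d}$ is obtained from the $d\times d$ sparsity matrix $I_d$ (with $\ast$ on the diagonal and $0$ elsewhere) by retaining the rows corresponding to the state vertices in $J$. For real matrices $\bar A\in\mathbb{R}^{d\times d}$, $\bar C\in\mathbb{R}^{p\times d}$, let $O_k(\bar A,\bar C)=\begin{pmatrix}\bar C^\top & (\bar C\bar A)^\top & \cdots & (\bar C\bar A^{k-1})^\top\end{pmatrix}^\top$. The structural observability index of a pair of sparsity matrices $(A,C)$ is $$\mu(A,C)=\inf\Big\{k\in[d]\ \Big|\ \sup_{A_1\in[A],\,C_1\in[C]}\operatorname{rank} O_k(A_1,C_1)=d\Big\},\qquad \inf\emptyset=+\infty .$$ A matching in an undirected graph is a set of edges with no shared endpoints; its incident vertices are called saturated, the other vertices unsaturated. A maximum weight matching maximizes the sum of the weights of its edges. *)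

(* Defs.v *)
From mathcomp Require Import all_boot all_order all_algebra.
From mathcomp Require Import classical_sets reals constructive_ereal ereal.

Set Implicit Arguments.
Unset Strict Implicit.
Unset Printing Implicit Defensive.

Import Order.TTheory GRing.Theory Num.Theory.

(* A sparsity matrix is a boolean matrix: [true] stands for a free entry
   ("star"), [false] for a fixed zero. *)

Definition realizations (R : realType) m n (H : 'M[bool]_(m, n)) :
    set 'M[R]_(m, n) :=
  (fun M => forall i j, H i j = false -> M i j = 0%R).

Arguments realizations R {m n} H _.

Definition sparsity_id d : 'M[bool]_d := \matrix_(i, j) (i == j).

(* Rows in increasing order of the state indices in J. *)
Definition sparsity_sel d (J : {set 'I_d}) : 'M[bool]_(#|J|, d) :=
  rowsub (fun r : 'I_#|J| => enum_val r) (sparsity_id d).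

(* State vertices are the ordinals; the star A_ij gives the edge from j to i. *)
Definition digraph_edges d (A : 'M[bool]_d) : {set 'I_d * 'I_d} :=
  [set xy : 'I_d * 'I_d | A xy.2 xy.1].

Section AuxiliaryGraph.

(* Undirected edges are the two-element sets of their endpoints. *)

Variables (d : nat) (A : 'M[bool]_d) (F : {set 'I_d}).

Definition inner_edges : {set {set 'I_d}} :=
  [set [set xi; xj] | xi in F, xj in F &
     (xi != xj) && (((xi, xj) \in digraph_edges A)
                    || ((xj, xi) \in digraph_edges A))].

Definition cross_edges : {set {set 'I_d}} :=
  [set [set xk; xm] | xk in ~: F, xm in F & (xk, xm) \in digraph_edges A].

Definition aux_edges : {set {set 'I_d}} := inner_edges :|: cross_edges.

Definition aux_weight (e : {set 'I_d}) : nat :=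
  if e \in cross_edges then #|aux_edges|.+1 else 1.

End AuxiliaryGraph.

Section Matchings.

Variables (V : finType) (E : {set {set V}}) (w : {set V} -> nat).

Definition matching (M : {set {set V}}) : Prop := M \subset E /\ finset.trivIset M.

Definition max_weight_matching (M : {set {set V}}) : Prop :=
  matching M /\
  forall M' : {set {set V}}, matching M' ->
    \sum_(e in M') w e <= \sum_(e in M) w e.

End Matchings.

(* [finset.cover M] is the set of saturated vertices, and [c] picks the endpoint that
   is kept from each matching edge. *)
Definition endpoint_selection d (A : 'M[bool]_d) (F : {set 'I_d})
    (M : {set {set 'I_d}}) (J : {set 'I_d}) : Prop :=
  exists c : {set 'I_d} -> 'I_d,
    (forall e, e \in M -> exists xi xj : 'I_d,
       [/\ e = [set xi; xj], c e = xj, (xi, xj) \in digraph_edges A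
         & e \in cross_edges A F -> xj \in F])
    /\ J = ~: finset.cover M :|: [set c e | e in M].

Definition procedure_output d (A : 'M[bool]_d) (F J : {set 'I_d}) : Prop :=
  exists M : {set {set 'I_d}},
    max_weight_matching (aux_edges A F) (aux_weight A F) M
    /\ endpoint_selection A F M J.

Section Observability.

Local Open Scope classical_set_scope.
Local Open Scope ring_scope.

Variable R : realType.

Definition obs_mx d p (k : nat) (A : 'M[R]_d) (C : 'M[R]_(p, d)) :=
  \mxcol_(i < k) (C *m (A ^+ i)).

Definition max_obs_rank d p (k : nat) (A : 'M[bool]_d) (C : 'M[bool]_(p, d)) :
    \bar R :=
  ereal_sup [set ((\rank (obs_mx k AC.1 AC.2))%:R)%:E
            | AC in realizations R A `*` realizations R C].

Definition obs_index d p (A : 'M[bool]_d) (C : 'M[bool]_(p, d)) : \bar R :=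
  ereal_inf [set (k%:R)%:E
            | k in [set k : nat | (1 <= k <= d)%N
                                  /\ max_obs_rank k A C = (d%:R)%:E]].

End Observability.

(* Main.v *)
Require Import Defs.
From mathcomp Require Import all_boot all_order all_algebra.
From mathcomp Require Import perm.
From mathcomp Require Import reals constructive_ereal ereal.

(** Observability within two steps is a combinatorial property of the digraph.
    The stacked matrix of [C] and [C A] has two rows for each output state [j]:
    the first can be nonzero only in column [j], the second only in the columns
    of the predecessors of [j].  It has full column rank for some realization
    exactly when each column can be assigned its own row with a free entry
    there.  A column outside [J] can only be assigned a second row, so the
    condition reads: the states outside [J] inject into [J] along edges of the
    digraph ([successor_injection], [obs_index_le2]).

    For [J] inside [F], such an injection [f] is a matching of the auxiliary
    graph, with edges {v, f v} for [v] outside [J]; it has d - |J| edges and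
    saturates the complement of [F] ([successor_injection_matching]).
    Conversely, keeping one admissible endpoint of each edge of a matching [M],
    together with the unsaturated vertices, leaves a set of d - |M| vertices,
    and the partners along [M] form a successor injection
    ([endpoint_selection_card], [endpoint_selection_successor_injection]).
    A smallest [J] inside [F] thus corresponds to a largest matching among
    those that saturate the complement of [F].

    The weights select these matchings.  Every cross edge has exactly one
    endpoint outside [F] and an inner edge has none, so the weight of [M] is
    |M| + N s, where N is the number of edges of the auxiliary graph and s the
    number of saturated vertices outside [F] ([weight_matching]).  As |M| <= N,
    a maximum weight matching first maximizes s, and then |M|.  The hypothesis
    on [F] provides a matching that saturates the complement of [F], so s is
    the size of that complement. *)

Set Implicit Arguments.
Unset Strict Implicit.
Unset Printing Implicit Defensive.

Import Order.TTheory GRing.Theory Num.Theory.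

(** * Full column rank and the value of the observability index *)

Section Rank.

Local Open Scope ring_scope.

Lemma det_neq0_perm (R : comNzRingType) n (B : 'M[R]_n) :
  \det B != 0 -> exists s : 'S_n, forall i, B i (s i) != 0.
Proof.
move=> detB.
have [/existsP [s /forallP sP]|/existsPn none] :=
  boolP [exists s : 'S_n, forall i, B i (s i) != 0]; first by exists s.
case/eqP: detB; rewrite /determinant big1 // => s _.
have /forallPn [i /negPn /eqP Bi0] := none s.
by rewrite (bigD1 i) //= Bi0 mul0r mulr0.
Qed.

(** A square submatrix of full rank has a nonzero term in the Leibniz expansion
    of its determinant, which assigns distinct rows to the columns. *)
Lemma row_full_transversal (K : fieldType) m n (B : 'M[K]_(m, n)) :
  row_full B ->
  exists2 f : 'I_n -> 'I_m, injective f & forall j, B (f j) j != 0.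
Proof.
move=> fullB.
have := fullrowsub_unit fullB; rewrite unitmxE unitfE.
case/det_neq0_perm => s sP.
exists (fun j => fullrankfun fullB (s^-1%g j)).
  by move=> i j /fullrankfun_inj /perm_inj.
by move=> j; have := sP (s^-1%g j); rewrite mxE permKV.
Qed.

Variable R : realType.

Lemma row_obs_mx d p k (A : 'M[R]_d) (C : 'M[R]_(p, d)) i j :
  row (@tagnat.Rank k (fun=> p) i j) (obs_mx k A C) = row j (C *m A ^+ i).
Proof.
rewrite -[in RHS](mxcolK (fun i : 'I_k => C *m A ^+ i) i).
by apply/rowP => l; rewrite !mxE.
Qed.

(** Ranks are integers bounded by [d], so a supremum equal to [d] is attained:
    otherwise [d - 1] would be an upper bound. *)
Lemma max_obs_rank_attained d p k (A : 'M[bool]_d) (C : 'M[bool]_(p, d)) :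
  (0 < d)%N -> max_obs_rank R k A C = (d%:R)%:E ->
  exists A1 C1, [/\ realizations R A A1, realizations R C C1
                  & row_full (obs_mx k A1 C1)].
Proof.
move=> d_gt0 supE.
have [//|none] := boolp.pselect (exists A1 C1, [/\ realizations R A A1,
  realizations R C C1 & row_full (obs_mx k A1 C1)]).
have : (max_obs_rank R k A C <= (d.-1%:R)%:E)%E.
  apply: ge_ereal_sup => _ [[A1 C1] [/= hA hC] <-].
  rewrite lee_fin ler_nat -ltnS prednK // ltn_neqAle rank_leq_col andbT.
  by apply/negP => full; apply: none; exists A1, C1.
by rewrite supE lee_fin ler_nat leqNgt prednK // leqnn.
Qed.

Lemma max_obs_rank_full d p k (A : 'M[bool]_d) (C : 'M[bool]_(p, d)) A1 C1 :
  realizations R A A1 -> realizations R C C1 -> row_full (obs_mx k A1 C1) ->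
  max_obs_rank R k A C = (d%:R)%:E.
Proof.
move=> hA hC /eqP full; apply/eqP; rewrite eq_le; apply/andP; split.
  apply: ge_ereal_sup => _ [[A2 C2] _ <-].
  by rewrite lee_fin ler_nat rank_leq_col.
by apply: ereal_sup_ubound; exists (A1, C1); rewrite //= full.
Qed.

(** The infimum is over natural numbers: if none of them is at most [n], then
    [n + 1] is a lower bound. *)
Lemma obs_index_le d p n (A : 'M[bool]_d) (C : 'M[bool]_(p, d)) :
  (obs_index R A C <= (n%:R)%:E)%E <->
  exists k, [/\ (1 <= k <= d)%N, (k <= n)%N & max_obs_rank R k A C = (d%:R)%:E].
Proof.
split=> [le_n | [k [kd kn maxE]]]; last first.
  apply: (@le_trans _ _ (k%:R)%:E); last by rewrite lee_fin ler_nat.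
  by apply: ereal_inf_lbound; exists k.
have [//|none] := boolp.pselect (exists k, [/\ (1 <= k <= d)%N, (k <= n)%N
  & max_obs_rank R k A C = (d%:R)%:E]).
have : ((n.+1%:R)%:E <= obs_index R A C)%E.
  apply: le_ereal_inf_tmp => _ [k [kd maxE] <-].
  rewrite lee_fin ler_nat ltnNge; apply/negP => kn.
  by apply: none; exists k.
by move=> /le_trans /(_ le_n); rewrite lee_fin ler_nat ltnn.
Qed.

End Rank.

(** * Two-step observability as an injection along edges *)

Definition successor_injection d (A : 'M[bool]_d) (J : {set 'I_d}) : Prop :=
  exists f : 'I_d -> 'I_d,
    [/\ {in ~: J, forall v, f v \in J},
        {in ~: J, forall v, (v, f v) \in digraph_edges A}
      & {in ~: J &, injective f}].

Section Observability.

Local Open Scope ring_scope.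

Variables (R : realType) (d : nat) (A : 'M[bool]_d) (J : {set 'I_d}).

Lemma realization_sel_neq0 (C1 : 'M[R]_(#|J|, d)) r v :
  realizations R (sparsity_sel J) C1 -> C1 r v != 0 -> enum_val r = v.
Proof.
move=> hC; apply: contra_neq_eq => ne; apply: hC.
by rewrite !mxE; apply: negbTE.
Qed.

Lemma realization_step_neq0 (A1 : 'M[R]_d) (C1 : 'M[R]_(#|J|, d)) r v :
  realizations R A A1 -> realizations R (sparsity_sel J) C1 ->
  (C1 *m A1) r v != 0 -> (v, enum_val r) \in digraph_edges A.
Proof.
move=> hA hC; rewrite inE /=; apply: contra_neqT => /negbTE Arv.
rewrite mxE big1 // => w _.
have [->|/(realization_sel_neq0 hC) <-] := eqVneq (C1 r w) 0.
  by rewrite mul0r.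
by rewrite hA ?mulr0.
Qed.

(** A column [v] outside [J] vanishes in the block [C], so the row that a
    transversal assigns to it lies in the block [C A] and belongs to an output
    state that is a successor of [v].  Distinct columns have distinct rows,
    hence distinct successors.  The bound [k <= 2] also covers [k = 1], where
    the block [C A] is absent. *)
Lemma obs_full_successor_injection k A1 (C1 : 'M[R]_(#|J|, d)) :
  (k <= 2)%N -> realizations R A A1 -> realizations R (sparsity_sel J) C1 ->
  row_full (obs_mx k A1 C1) -> successor_injection A J.
Proof.
move=> k2 hA hC /row_full_transversal [f f_inj f_neq0].
(* [lvl v] is the exponent of the block of row [f v], [r v] its row there. *)
pose lvl v : 'I_k := tagnat.sig1 (f v).
pose r v : 'I_#|J| := tagnat.sig2 (f v).
have fE v : f v = tagnat.Rank (lvl v) (r v) by rewrite tagnat.sig2K.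
have entry v : (C1 *m A1 ^+ lvl v) (r v) v != 0.
  by have := f_neq0 v; rewrite mxE.
have lvl1 v : v \in ~: J -> lvl v = 1%N :> nat.
  rewrite inE => vJ; have := entry v.
  have: (lvl v < 2)%N by exact: leq_trans (ltn_ord _) k2.
  case: (nat_of_ord (lvl v)) => [|[|//]] _ //.
  rewrite expr0 mulmx1 => /(realization_sel_neq0 hC) vE.
  by move: vJ; rewrite -vE enum_valP.
exists (fun v => enum_val (r v)); split=> [v _|v vJ|v w vJ wJ].
- exact: enum_valP.
- by apply: realization_step_neq0 hA hC _; have := entry v; rewrite lvl1.
- move=> /enum_val_inj rE; apply: f_inj; rewrite !fE rE.
  by have -> : lvl v = lvl w by apply: val_inj; rewrite /= !lvl1.
Qed.

(** Keeping in [A] only the edges (v, f v) with unit weight makes every unit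
    row vector a row of the stacked matrix: that of [v] in [J] is the output
    row of [v], and that of [v] outside [J] is the row of [f v] one step later,
    which has no other nonzero entry because [f] is injective. *)
Lemma successor_injection_max_obs_rank :
  successor_injection A J ->
  max_obs_rank R 2 A (sparsity_sel J) = (d%:R)%:E.
Proof.
case=> f [fJ fA f_inj].
pose C1 : 'M[R]_(#|J|, d) := \matrix_(r, v) (enum_val r == v)%:R.
pose A1 : 'M[R]_d := \matrix_(i, v) ((v \notin J) && (f v == i))%:R.
apply: (@max_obs_rank_full R _ _ _ _ _ A1 C1).
- move=> i v Aiv; rewrite mxE; case: andP => // -[vJ /eqP fvi].
  by have := fA v; rewrite !inE /= fvi Aiv => /(_ vJ).
- by move=> r v; rewrite !mxE => ->.
have rowC r : row r C1 = delta_mx 0 (enum_val r).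
  by apply/rowP => v; rewrite !mxE eqxx [RHS]/= eq_sym.
rewrite -sub1mx; apply/row_subP => v; rewrite row1.
have [vJ|vJ] := boolP (v \in J).
- pose s := @tagnat.Rank 2 (fun=> #|J|) ord0 (enum_rank_in vJ v).
  have <- : row s (obs_mx 2 A1 C1) = delta_mx 0 v; last exact: row_sub.
  by rewrite row_obs_mx expr0 mulmx1 rowC enum_rankK_in.
- have vJ' : v \in ~: J by rewrite inE.
  have fvJ := fJ v vJ'.
  pose s := @tagnat.Rank 2 (fun=> #|J|) ord_max (enum_rank_in fvJ (f v)).
  have <- : row s (obs_mx 2 A1 C1) = delta_mx 0 v; last exact: row_sub.
  rewrite row_obs_mx expr1 row_mul rowC enum_rankK_in // -rowE.
  suff dst w : (w \notin J) && (f w == f v) = (w == v).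
    by apply/rowP => w; rewrite !mxE eqxx dst.
  have [->|ne] := eqVneq w v; first by rewrite vJ eqxx.
  apply/negbTE/nandP; have [wJ|wJ] := boolP (w \in J); [by left|right].
  by apply: contra_neq ne => /f_inj; apply; rewrite // inE.
Qed.

Lemma obs_index_le2 :
  (2 <= d)%N ->
  (obs_index R A (sparsity_sel J) <= 2%:E)%E <-> successor_injection A J.
Proof.
move=> d2; rewrite obs_index_le; split=> [[k [kd k2 maxE]]|inj].
  have [|A1 [C1 [hA hC full]]] := max_obs_rank_attained _ maxE.
    exact: ltnW.
  exact: obs_full_successor_injection k2 hA hC full.
by exists 2%N; split=> //; exact: successor_injection_max_obs_rank.
Qed.

End Observability.

(** * Weights of matchings in the auxiliary graph *)

Section Matching.

Variables (d : nat) (A : 'M[bool]_d) (F : {set 'I_d}).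

Lemma card_outside_inner e : e \in inner_edges A F -> #|e :\: F| = 0.
Proof.
case/imset2P => x y xF; rewrite inE => /andP[yF _] ->.
apply/eqP; rewrite cards_eq0 setD_eq0; apply/subsetP => z.
by rewrite !inE => /orP[] /eqP ->.
Qed.

Lemma card_outside_cross e : e \in cross_edges A F -> #|e :\: F| = 1.
Proof.
case/imset2P => x y; rewrite !inE => xF /andP[yF _] ->.
suff -> : [set x; y] :\: F = [set x] by rewrite cards1.
apply/setP => z; rewrite !inE; case: (eqVneq z x) => [->|_] /=.
  by rewrite xF.
by case: (eqVneq z y) => [->|]; rewrite ?yF ?andbF.
Qed.

Lemma card_outside e :
  e \in aux_edges A F -> #|e :\: F| = (e \in cross_edges A F).
Proof.
rewrite inE orbC; case: (boolP (e \in cross_edges A F)) => [eX _|_] /=.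
  exact: card_outside_cross eX.
exact: card_outside_inner.
Qed.

Lemma card_aux_edge e : e \in aux_edges A F -> #|e| = 2.
Proof.
case/setUP => /imset2P[x y xF]; rewrite inE => /andP[yF h] ->; rewrite cards2.
  by case/andP: h => ->.
by case: eqVneq => // xy; move: xF; rewrite inE xy yF.
Qed.

Variable M : {set {set 'I_d}}.
Hypothesis mM : matching (aux_edges A F) M.

Lemma card_cover_matching : #|finset.cover M| = #|M|.*2.
Proof.
case: mM => /subsetP sM /eqP <-.
rewrite -mul2n mulnC -sum_nat_const; apply: eq_bigr => e /sM.
exact: card_aux_edge.
Qed.

(** Each cross edge saturates one vertex outside [F], an inner edge none, and
    the edges of a matching are disjoint. *)
Lemma card_cover_outside :
  #|finset.cover M :\: F| = #|M :&: cross_edges A F|.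
Proof.
case: mM => /subsetP sM tM.
transitivity (\sum_(x in finset.cover M) (x \notin F)).
  rewrite -sum1_card big_mkcond [RHS]big_mkcond; apply: eq_bigr => x _ /=.
  by rewrite inE; case: (x \in F); case: (x \in _).
rewrite big_trivIset //= -sum1_card.
rewrite [RHS](eq_bigl (fun e => (e \in M) && (e \in cross_edges A F))).
  rewrite [RHS]big_mkcondr; apply: eq_bigr => e /sM /card_outside.
  move=> cE; transitivity (e \in cross_edges A F : nat); last by case: (_ \in _).
  rewrite -cE -sum1_card big_mkcond [RHS]big_mkcond; apply: eq_bigr => x _ /=.
  by rewrite inE; case: (x \in F); case: (x \in _).
by move=> e; rewrite inE.
Qed.

(** This form shows that the weight orders matchings lexicographically, by the
    saturated vertices outside [F] and then by the number of edges. *)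
Lemma weight_matching :
  \sum_(e in M) aux_weight A F e =
  #|M| + #|aux_edges A F| * #|finset.cover M :\: F|.
Proof.
rewrite card_cover_outside -(sum1_card (mem M)) -(sum1_card (mem (M :&: _))).
rewrite big_distrr /=.
rewrite [X in _ = _ + X](eq_bigl
  (fun e => (e \in M) && (e \in cross_edges A F))).
  rewrite [X in _ = _ + X]big_mkcondr -big_split /=; apply: eq_bigr => e _.
  by rewrite /aux_weight; case: ifP => _; rewrite ?addn0 ?muln1 ?add1n.
by move=> e; rewrite inE.
Qed.

End Matching.

(** * Matchings, injections and optimality *)

Section Optimality.

Variables (d : nat) (A : 'M[bool]_d) (F : {set 'I_d}).

(** The edges {v, f v} are disjoint: sources lie outside [J], targets lie in
    [J], and [f] is injective.  As targets lie in [F], such an edge is inner or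
    cross according to whether its source is in [F]. *)
Lemma successor_injection_matching (J : {set 'I_d}) :
  J \subset F -> successor_injection A J ->
  exists M, [/\ matching (aux_edges A F) M, #|M| = #|~: J|
              & ~: J \subset finset.cover M].
Proof.
move=> /subsetP JF [f [fJ fA f_inj]].
pose e v := [set v; f v].
have meet v w z : v \in ~: J -> w \in ~: J -> z \in e v -> z \in e w -> v = w.
  move=> vJ wJ; rewrite !inE => /orP[]/eqP-> /orP[]/eqP E //.
  - by move: vJ; rewrite inE E fJ.
  - by move: wJ; rewrite inE -E fJ.
  - exact: f_inj.
have e_inj : {in ~: J &, injective e}.
  move=> v w vJ wJ E; apply: (meet v w v) => //; first by rewrite !inE eqxx.
  by rewrite -E !inE eqxx.
exists [set e v | v in ~: J]; split.
- split; last first.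
    apply/trivIsetP => _ _ /imsetP[v vJ ->] /imsetP[w wJ ->].
    apply: contraR => /pred0Pn [z /= /andP[zv zw]].
    by apply/eqP; congr e; exact: meet zv zw.
  apply/subsetP => _ /imsetP[v vJ ->]; rewrite inE.
  have fF := JF _ (fJ v vJ).
  have [vF|vF] := boolP (v \in F); apply/orP; [left|right].
    apply: imset2_f => //; rewrite inE fF fA //= andbT.
    by apply: contraTneq (fJ v vJ) => <-; rewrite inE in vJ.
  by apply: imset2_f; rewrite inE // fF fA.
- exact: card_in_imset.
apply/subsetP => v vJ; apply/bigcupP; exists (e v); first exact: imset_f.
by rewrite !inE eqxx.
Qed.

(** Missing one vertex outside [F] costs the number of edges of the auxiliary
    graph, which is at least the size of any matching.  Hence a matching with
    a miss weighs no more than the second term of the weight of the matching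
    given by [F], whose first term is the size of the complement of [F]. *)
Lemma max_weight_matching_covers (M : {set {set 'I_d}}) :
  successor_injection A F ->
  max_weight_matching (aux_edges A F) (aux_weight A F) M ->
  ~: F \subset finset.cover M.
Proof.
move=> /(successor_injection_matching (subxx F)) [MF [mMF cMF sMF]] [mM maxM].
have subM : #|M| <= #|aux_edges A F| by apply: subset_leq_card; case: mM.
have -> : (~: F \subset finset.cover M) = (#|~: F| <= #|finset.cover M :\: F|).
  rewrite setDE setIC; apply/idP/idP => [/setIidPl -> //|le].
  by apply/setIidPl/eqP; rewrite eqEcard subsetIl.
have := maxM _ mMF; rewrite !weight_matching // cMF.
have -> : finset.cover MF :\: F = ~: F.
  by rewrite setDE setIC; apply/setIidPl.
move=> le; rewrite leqNgt; apply/negP => lt.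
(* The complement of [F] has an unsaturated vertex, but comparing the weights
   shows that it is empty. *)
have := leq_ltn_trans (leq0n _) lt; rewrite ltnNge => /negP; apply.
have le2 := leq_mul (leqnn #|aux_edges A F|) lt; rewrite mulnS in le2.
rewrite -(leq_add2r (#|aux_edges A F| * #|~: F|)) add0n.
by apply: leq_trans le (leq_trans _ le2); rewrite leq_add2r.
Qed.

(** [M] and the matching given by [J] saturate the same vertices outside [F],
    so comparing their weights compares their sizes. *)
Lemma max_weight_matching_card M (J : {set 'I_d}) :
  successor_injection A F ->
  max_weight_matching (aux_edges A F) (aux_weight A F) M ->
  J \subset F -> successor_injection A J -> #|~: J| <= #|M|.
Proof.
move=> injF maxM JF injJ.
have sM := max_weight_matching_covers injF maxM.
case: maxM => mM maxM.
have [MJ [mMJ cMJ sMJ]] := successor_injection_matching JF injJ.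
have := maxM _ mMJ; rewrite !weight_matching // cMJ.
have outside N : ~: F \subset finset.cover N -> finset.cover N :\: F = ~: F.
  by move=> sN; rewrite setDE setIC; apply/setIidPl.
rewrite !outside ?leq_add2r //.
by apply: subset_trans sMJ; rewrite setCS.
Qed.

(** Exactly one of the two endpoints of each edge of [M] is dropped. *)
Lemma endpoint_selection_card M J :
  matching (aux_edges A F) M -> endpoint_selection A F M J -> #|J| + #|M| = d.
Proof.
move=> mM [c [cP ->]].
have [sM tM] := mM.
have c_in e : e \in M -> c e \in e.
  by case/cP => x [y [-> -> _ _]]; rewrite !inE eqxx orbT.
have c_inj : {in M &, injective c}.
  move=> e e' eM e'M cE; rewrite -(def_pblock tM eM (c_in _ eM)).
  by rewrite cE (def_pblock tM e'M) // c_in.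
have c_cover : [set c e | e in M] \subset finset.cover M.
  by apply/subsetP => _ /imsetP[e eM ->]; apply/bigcupP; exists e; rewrite ?c_in.
rewrite cardsU (card_in_imset c_inj).
have -> : ~: finset.cover M :&: [set c e | e in M] = finset.set0.
  by apply/eqP; rewrite setI_eq0 disjoints_subset setCS.
rewrite cards0 subn0 -addnA addnn -(card_cover_matching mM) addnC cardsC.
exact: card_ord.
Qed.

Lemma endpoint_selection_sub (M : {set {set 'I_d}}) J :
  M \subset aux_edges A F -> ~: F \subset finset.cover M ->
  endpoint_selection A F M J -> J \subset F.
Proof.
move=> /subsetP sM cF [c [cP ->]]; rewrite subUset -setCS setCK cF /=.
apply/subsetP => _ /imsetP[e eM ->].
have [x [y [eE -> _ yF]]] := cP e eM.
case/setUP: (sM e eM) => [/card_outside_inner/eqP|/yF //].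
rewrite cards_eq0 setD_eq0 => /subsetP; apply.
by rewrite eE !inE eqxx orbT.
Qed.

(** A vertex outside the selection is the dropped endpoint of an edge of [M],
    and the endpoint kept from that edge is its successor. *)
Lemma endpoint_selection_successor_injection (M : {set {set 'I_d}}) J :
  finset.trivIset M ->
  endpoint_selection A F M J -> successor_injection A J.
Proof.
move=> tM [c [cP ->]].
have out v : v \in ~: (~: finset.cover M :|: [set c e | e in M]) ->
    exists e, [/\ e \in M, finset.pblock M v = e, e = [set v; c e], v != c e
                & (v, c e) \in digraph_edges A].
  rewrite !inE negb_or negbK => /andP[/bigcupP[e eM ve] nc].
  have [x [y [eE cE xyA _]]] := cP e eM; exists e.
  have vx : v = x.
    move: ve; rewrite eE !inE => /orP[]/eqP // vy.
    by case/negP: nc; apply/imsetP; exists e; rewrite ?cE.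
  split; rewrite ?(def_pblock tM eM ve) // ?cE ?vx //.
  by apply: contraNneq nc => xy; apply/imsetP; exists e; rewrite // cE vx.
exists (fun v => c (finset.pblock M v)); split=> [v vJ|v vJ|v w vJ wJ].
- by case: (out v vJ) => e [eM -> _ _ _]; rewrite !inE imset_f ?orbT.
- by case: (out v vJ) => e [_ -> _ _].
case: (out v vJ) (out w wJ) => e [eM -> eE v_ne _] [e' [e'M -> e'E _ _]] cE.
have e_c : c e \in e by rewrite {2}eE !inE eqxx orbT.
have e'_c : c e \in e' by rewrite cE {2}e'E !inE eqxx orbT.
have ee' : e = e' by rewrite -(def_pblock tM eM e_c) (def_pblock tM e'M e'_c).
have : v \in e' by rewrite -ee' eE !inE eqxx.
by rewrite e'E !inE -cE (negbTE v_ne) orbF => /eqP.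
Qed.

End Optimality.

Theorem lemma4p1 (R : realType) (d : nat) (A : 'M[bool]_d)
    (F Jstar : {set 'I_d}) :
  2 <= d ->
  ~: F != finset.set0 ->
  (obs_index R A (sparsity_sel F) <= 2%:E)%E ->
  procedure_output A F Jstar ->
  [/\ Jstar \subset F,
      (obs_index R A (sparsity_sel Jstar) <= 2%:E)%E
    & forall J : {set 'I_d}, J \subset F ->
        (obs_index R A (sparsity_sel J) <= 2%:E)%E -> #|Jstar| <= #|J|].
Proof.
move=> d2 _ /(obs_index_le2 R A _ d2) injF [M [maxM sel]].
have [[sM tM] _] := maxM.
split=> [||J JF /(obs_index_le2 R A _ d2) injJ].
- exact: endpoint_selection_sub sM (max_weight_matching_covers injF maxM) sel.
- exact/(obs_index_le2 R A _ d2)/(endpoint_selection_successor_injection tM sel).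
rewrite -(leq_add2r #|M|) (endpoint_selection_card (conj sM tM) sel).
rewrite -[X in X <= _]card_ord -(cardsC J) leq_add2l.
exact: max_weight_matching_card injF maxM JF injJ.
Qed.
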